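(* Let $\alpha,\delta,\eta:[t_0,T]\to\mathbb{R}$ be differentiable functions and $\mu:[t_0,T]\to(0,+\infty)$ a differentiable function. Let $h:\mathbb{R}^n\to\mathbb{R}$ be twice differentiable and strongly convex, let $f:\mathbb{R}^n\to\mathbb{R}$ be a (possibly nondifferentiable) convex function, and let $\widetilde f(\cdot,\mu)$ be a $(1/\mu)$-smooth approximation of $f$. Consider the Lagrangian $$\mathcal{L}(x,v,t)=e^{\delta(t)}\bigl(e^{\eta(t)}\mathcal{D}_h(x+e^{-\alpha(t)}v,\,x)-\widetilde f(x,\mu(t))\bigr),$$ and put $z(t)=x(t)+e^{-\alpha(t)}\dot x(t)$. Then the Euler--Lagrange equation $$\frac{d}{dt}\nabla_v\mathcal{L}(x(t),\dot x(t),t)-\nabla_x\mathcal{L}(x(t),\dot x(t),t)=0$$ results in the state equation $$\begin{cases}\dot x(t)=e^{\alpha(t)}(z(t)-x(t)),\\ \nabla^2h(z(t))\,\dot z(t)=-\bigl(\dot\delta(t)+\dot\eta(t)-\dot\alpha(t)-e^{\alpha(t)}\bigr)\bigl[\nabla h(z(t))-\nabla h(x(t))\bigr]-e^{-\eta(t)+\alpha(t)}\nabla_x\widetilde f(x(t),\mu(t)),\end{cases}$$ and this state equation is expressed by the ODE $$\ddot x(t)+(e^{\alpha(t)}-\dot\alpha(t))\dot x(t)+[\nabla^2h(z(t))]^{-1}\Bigl(e^{\alpha(t)}\bigl(\dot\delta(t)+\dot\eta(t)-\dot\alpha(t)-e^{\alpha(t)}\bigr)[\nabla h(z(t))-\nabla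 h(x(t))]+e^{-\eta(t)+2\alpha(t)}\nabla_x\widetilde f(x(t),\mu(t))\Bigr)=0.$$
   Context: The Bregman divergence of a differentiable convex function $h$ is $\mathcal{D}_h(y,x)=h(y)-h(x)-\nabla h(x)^\top(y-x)$. Given a convex $f:\mathbb{R}^n\to\mathbb{R}$, a function $\widetilde f:\mathbb{R}^n\times(0,\infty)\to\mathbb{R}$, convex and differentiable in its first argument, is called a $(1/\mu)$-smooth approximation of $f$ with parameters $(a,\beta)$, where $a,\beta>0$, if for every $\mu>0$: (1) $\widetilde f(x,\mu)\le f(x)\le\widetilde f(x,\mu)+\beta\mu$ for all $x$; (2) $\widetilde f(\cdot,\mu)$ is $(a/\mu)$-smooth, i.e. its gradient $\nabla_x\widetilde f(\cdot,\mu)$ is Lipschitz continuous with constant $a/\mu$. $\nabla_x\mathcal{L}$ and $\nabla_v\mathcal{L}$ denote the partial gradients of $\mathcal{L}(x,v,t)$ in its first and second arguments, evaluated at the indicated point. A dot denotes $d/dt$. It is assumed that the ODE has a (twice differentiable) solution $x(t)$ on $[t_0,T]$. *)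

(* Defs.v *)
From HB Require Import structures.
From mathcomp Require Import all_boot all_order all_algebra.
From mathcomp Require Import all_classical all_reals all_analysis.

Set Implicit Arguments.
Unset Strict Implicit.
Unset Printing Implicit Defensive.
Import Order.TTheory GRing.Theory Num.Theory.
Import numFieldNormedType.Exports.

Local Open Scope classical_set_scope.
Local Open Scope ring_scope.

(* R^n is 'cV[R]_n. The library norm `|x| on matrices is the max norm, hence the explicit
   Euclidean inner product and norm. *)
Definition dotv (R : realType) (n : nat) (u v : 'cV[R]_n) : R :=
  (u^T *m v) 0 0.

Definition enorm (R : realType) (n : nat) (u : 'cV[R]_n) : R :=
  Num.sqrt (dotv u u).

Definition grad (R : realType) (n : nat) (g : 'cV[R]_n -> R) (x : 'cV[R]_n) :
    'cV[R]_n :=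
  \col_i 'D_(delta_mx i 0) g x.

Definition hess (R : realType) (n : nat) (g : 'cV[R]_n -> R) (x : 'cV[R]_n) :
    'M[R]_n :=
  \matrix_(i, j) 'D_(delta_mx j 0) (fun y => 'D_(delta_mx i 0) g y) x.

(* Frechet differentiability of g and of its gradient; the second derivative
   is not required to be continuous. *)
Definition twice_differentiable (R : realType) (n : nat) (g : 'cV[R]_n -> R) :
    Prop :=
  (forall x, differentiable g x) /\ (forall x, differentiable (grad g) x).

Definition strongly_convex (R : realType) (n : nat) (g : 'cV[R]_n -> R) :
    Prop :=
  exists2 sigma : R, 0 < sigma &
    forall (x y : 'cV[R]_n) (t : R), 0 <= t <= 1 ->
      g (t *: x + (1 - t) *: y) <=
        t * g x + (1 - t) * g y
        - sigma / 2 * t * (1 - t) * enorm (x - y) ^+ 2.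

(* Differentiation relative to A: for A = [a, b] the difference quotient is
   one-sided at the endpoints, and only the values of g on A matter when
   t is in A. *)
Definition diff_quot (R : realType) (V : normedModType R) (g : R -> V)
    (t s : R) : V :=
  (s - t)^-1 *: (g s - g t).

Definition derivable_in (R : realType) (V : normedModType R) (A : set R)
    (g : R -> V) (t : R) : Prop :=
  cvg (diff_quot g t s @[s --> within A t^']).

Definition derive_in (R : realType) (V : normedModType R) (A : set R)
    (g : R -> V) (t : R) : V :=
  lim (diff_quot g t s @[s --> within A t^']).

Definition twice_derivable_in (R : realType) (V : normedModType R) (A : set R)
    (g : R -> V) : Prop :=
  forall t, A t -> derivable_in A g t /\ derivable_in A (derive_in A g) t.

Definition bregman (R : realType) (n : nat) (h : 'cV[R]_n -> R)
    (y x : 'cV[R]_n) : R :=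
  h y - h x - dotv (grad h x) (y - x).

(* ft x mu is only constrained for mu > 0. *)
Definition smooth_approximation (R : realType) (n : nat) (f : 'cV[R]_n -> R)
    (ft : 'cV[R]_n -> R -> R) (a beta : R) : Prop :=
  [/\ 0 < a, 0 < beta &
    forall mu : R, 0 < mu ->
      [/\ convex_function setT (ft^~ mu),
          forall x, differentiable (ft^~ mu) x,
          forall x, ft x mu <= f x <= ft x mu + beta * mu &
          forall x y,
            enorm (grad (ft^~ mu) x - grad (ft^~ mu) y)
              <= a / mu * enorm (x - y)]].

Definition lagrangian (R : realType) (n : nat) (h : 'cV[R]_n -> R)
    (ft : 'cV[R]_n -> R -> R) (alpha delta eta mu : R -> R)
    (x v : 'cV[R]_n) (t : R) : R :=
  expR (delta t) *
    (expR (eta t) * bregman h (x + expR (- alpha t) *: v) x - ft x (mu t)).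

Definition euler_lagrange (R : realType) (n : nat) (A : set R)
    (L : 'cV[R]_n -> 'cV[R]_n -> R -> R) (x : R -> 'cV[R]_n) (t : R) : Prop :=
  let dx := derive_in A x in
  derive_in A (fun s => grad (fun v => L (x s) v s) (dx s)) t
    - grad (fun y => L y (dx t) t) (x t) = 0.

Definition state_equation (R : realType) (n : nat) (A : set R)
    (h : 'cV[R]_n -> R) (ft : 'cV[R]_n -> R -> R)
    (alpha delta eta mu : R -> R) (x z : R -> 'cV[R]_n) (t : R) : Prop :=
  derive_in A x t = expR (alpha t) *: (z t - x t) /\
  hess h (z t) *m derive_in A z t =
    - ((derive_in A delta t + derive_in A eta t - derive_in A alpha t
         - expR (alpha t)) *: (grad h (z t) - grad h (x t)))
    - expR (- eta t + alpha t) *: grad (ft^~ (mu t)) (x t).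

Definition second_order_ode (R : realType) (n : nat) (A : set R)
    (h : 'cV[R]_n -> R) (ft : 'cV[R]_n -> R -> R)
    (alpha delta eta mu : R -> R) (x z : R -> 'cV[R]_n) (t : R) : Prop :=
  derive_in A (derive_in A x) t
  + (expR (alpha t) - derive_in A alpha t) *: derive_in A x t
  + invmx (hess h (z t)) *m
      ((expR (alpha t) *
          (derive_in A delta t + derive_in A eta t - derive_in A alpha t
            - expR (alpha t))) *: (grad h (z t) - grad h (x t))
       + expR (- eta t + 2 * alpha t) *: grad (ft^~ (mu t)) (x t)) = 0.

(* Main.v *)
(* The mechanical part is that the Euler-Lagrange expression equals
   e^(delta + eta - alpha) times the residual of the second state equation, and
   that the left-hand side of the second-order ODE equals
   e^alpha * (hess h z)^-1 times the same residual; the first state equation is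
   the definition of z. The terms in hess h (x t) *m x'(t) produced by d/dt grad_v
   and by grad_x cancel only because the Hessian is symmetric. Since the second
   derivative of h need not be continuous, symmetry is obtained from Frechet
   differentiability of grad h, via the limit of the second differences
   (h(x+sv+su) - h(x+su) - h(x+sv) + h(x)) / s^2. With u = v, the same limit and
   strong convexity give the invertibility of the Hessian. *)
From HB Require Import structures.
Require Import Defs.
From mathcomp Require Import all_boot all_order all_algebra.
From mathcomp Require Import all_classical all_reals all_analysis ring lra.
Import Order.TTheory GRing.Theory Num.Theory.
Import numFieldNormedType.Exports.
Local Open Scope classical_set_scope.
Local Open Scope ring_scope.
Set Implicit Arguments.
Unset Strict Implicit.
Unset Printing Implicit Defensive.

(** * Euclidean inner product *)

Lemma dotvE (R : realType) (n : nat) (u v : 'cV[R]_n) :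
  dotv u v = \sum_i u i 0 * v i 0.
Proof. by rewrite /dotv mxE; apply: eq_bigr => i _; rewrite mxE. Qed.

Lemma dotvC (R : realType) (n : nat) (u v : 'cV[R]_n) : dotv u v = dotv v u.
Proof. by rewrite !dotvE; apply: eq_bigr => i _; rewrite mulrC. Qed.

Lemma dotvDl (R : realType) (n : nat) (u v w : 'cV[R]_n) :
  dotv (u + v) w = dotv u w + dotv v w.
Proof. by rewrite /dotv linearD mulmxDl mxE. Qed.

Lemma dotvZl (R : realType) (n : nat) (k : R) (u w : 'cV[R]_n) :
  dotv (k *: u) w = k * dotv u w.
Proof. by rewrite /dotv linearZ -scalemxAl mxE. Qed.

Lemma dotvBl (R : realType) (n : nat) (u v w : 'cV[R]_n) :
  dotv (u - v) w = dotv u w - dotv v w.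
Proof. by rewrite dotvDl -scaleN1r dotvZl mulN1r. Qed.

Lemma dotv_mulmx (R : realType) (n : nat) (A : 'M[R]_n) (u v : 'cV[R]_n) :
  dotv (A *m u) v = dotv u (A^T *m v).
Proof. by rewrite /dotv trmx_mul mulmxA. Qed.

Lemma dotv_delta (R : realType) (n : nat) (u : 'cV[R]_n) i :
  dotv u (delta_mx i 0) = u i 0.
Proof.
rewrite dotvE (bigD1 i) //= mxE !eqxx mulr1 big1 ?addr0 // => j ji.
by rewrite mxE (negbTE ji) mulr0.
Qed.

Lemma dotv_eq0 (R : realType) (n : nat) (u : 'cV[R]_n) :
  dotv u u = 0 -> u = 0.
Proof.
rewrite dotvE => /eqP; rewrite psumr_eq0 => [/allP u0|i _]; last first.
  by rewrite -expr2 sqr_ge0.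
apply/colP => i; rewrite mxE; have := u0 i (mem_index_enum i).
by rewrite mulf_eq0 orbb => /eqP.
Qed.

(** * Differentials, gradients and Hessians *)

Lemma is_diff_dotvl (R : realType) (n : nat) (w x : 'cV[R]_n) :
  is_diff x (fun u => dotv u w) (fun u => dotv u w).
Proof.
have lin : linear (fun u : 'cV[R]_n => dotv u w).
  by move=> k u v; rewrite dotvDl dotvZl.
pose L := GRing.isLinear.Build _ _ _ _ _ lin.
pose f : {linear 'cV[R]_n -> R} := HB.pack (fun u : 'cV[R]_n => dotv u w) L.
have cf : continuous f.
  rewrite /f /= (_ : (fun u => dotv u w) =
    (fun u => \sum_i u i 0 * w i 0)); last by apply/funext => v; rewrite dotvE.
  apply: continuous_big => [|i _ u]; first exact: add_continuous.
  exact: (cvgMr_tmp (b := w i 0) (@coord_continuous R n 1 i 0 u)).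
by apply: DiffDef; [exact: (@linear_differentiable _ _ _ f) |
  exact: (@diff_lin _ _ _ f)].
Qed.

Lemma is_diff_grad (R : realType) (n : nat) (g : 'cV[R]_n -> R) x :
  differentiable g x -> is_diff x g (dotv (grad g x)).
Proof.
move=> dg; apply: DiffDef => //; apply/funext => v.
rewrite [in LHS](matrix_sum_delta v) linear_sum dotvE; apply: eq_bigr => i _.
by rewrite big_ord1 linearZ /= mxE deriveE // mulrC.
Qed.

(** Reads a gradient off a differential written as an inner product; both partial gradients of the
    Lagrangian are computed this way. *)
Lemma grad_is_diff (R : realType) (n : nat) (g : 'cV[R]_n -> R) x w :
  is_diff x g (dotv w) -> grad g x = w.
Proof.
move=> dg; apply/colP => i.
by rewrite mxE deriveE ?diff_val ?dotv_delta //; exact: ex_diff.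
Qed.

(** Row [i] of the Hessian is the gradient of the [i]-th coordinate of [grad h], so the two linear
    maps agree coordinate by coordinate. *)
Lemma is_diff_grad_hess (R : realType) (n : nat) (h : 'cV[R]_n -> R) x :
  differentiable (grad h) x -> is_diff x (grad h) (mulmx (hess h x)).
Proof.
move=> dh; apply: DiffDef => //; apply/funext => v; apply/colP => i.
have dc := @differentiable_coord R n 1 (grad h x) i 0.
have dhi : differentiable (fun y => grad h y i 0) x.
  exact: (differentiable_comp dh dc).
transitivity ('d (fun y => grad h y i 0) x v).
  have : is_diff (grad h x) (fun N : 'cV[R]_n => N i 0 : R) (fun N => N i 0).
    have := @is_diff_dotvl R n (delta_mx i 0) (grad h x).
    by under eq_fun do rewrite dotv_delta.
  move=> dc'; have dcomp := is_diff_comp (differentiableP dh) dc'.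
  exact: esym (congr1 (fun k => k v) (@diff_val _ _ _ _ _ _ _ dcomp)).
transitivity (dotv (grad (fun y => grad h y i 0) x) v).
  exact: (congr1 (fun k => k v) (@diff_val _ _ _ _ _ _ _ (is_diff_grad dhi))).
have -> : (fun y => grad h y i 0) = 'D_(delta_mx i 0) h.
  by apply/funext => y; rewrite [LHS]mxE.
by rewrite dotvE mxE; apply: eq_bigr => j _; rewrite [X in X * _]mxE [in RHS]mxE.
Qed.

Lemma is_diff_near (R : realType) (V W : normedModType R) (f df : V -> W) x :
  is_diff x f df -> forall e : R, 0 < e ->
  \forall w \near (0 : V), `|f (x + w) - f x - df w| <= e * `|w|.
Proof.
move=> dfx e e0; have /diff_locally : differentiable f x by exact: ex_diff.
move=> /eqaddoP /(_ e e0); apply: filter_app; near=> w.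
rewrite diff_val /= => H; apply: le_trans H.
by rewrite /= !fctE [w + x]addrC opprD addrA.
Unshelve. all: by end_near. Qed.

(** * Second differences *)

Lemma is_derive_line (R : realType) (n : nat) (h : 'cV[R]_n -> R) p w (r : R) :
  differentiable h (p + r *: w) ->
  is_derive r 1 (fun k : R => h (p + k *: w)) (dotv (grad h (p + r *: w)) w).
Proof.
move=> dh; have dl : is_diff r (cst p + *:%R^~ w) (0 + *:%R^~ w).
  exact: is_diffD.
have dhl : is_diff r (h \o (cst p + *:%R^~ w))
    (dotv (grad h (p + r *: w)) \o (0 + *:%R^~ w)).
  by apply: is_diff_comp; exact: is_diff_grad.
have dhl' := @ex_diff _ _ _ _ _ _ _ dhl.
apply: DeriveDef; first exact: diff_derivable.
rewrite deriveE // (congr1 (fun k => k 1) (@diff_val _ _ _ _ _ _ _ dhl)).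
by rewrite /= !fctE add0r scale1r.
Qed.

(* Mean value theorem along u for k |-> h(x+sv+ksu) - h(x+ksu) on [0,1], then the
   first-order expansion of grad h at x for both resulting gradients. *)
Lemma second_difference_cvg (R : realType) (n : nat) (h : 'cV[R]_n -> R)
    (x u v : 'cV[R]_n) :
  (forall y, differentiable h y) -> differentiable (grad h) x ->
  s ^- 2 * (h (x + s *: v + s *: u) - h (x + s *: u)
    - (h (x + s *: v) - h x)) @[s --> (0 : R)^'] --> dotv (hess h x *m v) u.
Proof.
move=> dh dgh; pose g y := dotv (grad h y) u.
pose L w := dotv (hess h x *m w) u.
have dg : is_diff x g L.
  exact: (is_diff_comp (is_diff_grad_hess dgh) (is_diff_dotvl u (grad h x))).
apply/cvgrPdist_le => e e0.
(* [K] dominates |c u| and |v + c u| for every c in [0, 1], and also their sum; this sum absorbs the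
   division by [K] in [e / K]. *)
pose K := `|u| + `|v| + `|u| + 1.
have K0 : 0 < K by rewrite ltr_wpDl // !addr_ge0.
have /(is_diff_near dg) : 0 < e / K by rewrite divr_gt0.
move=> /nbhs_ballP[r /= r0 rg].
near=> s.
have s0 : s != 0 by near: s; exact: nbhs_dnbhs_neq.
have sr : `|s| < r / K by near: s; apply: dnbhs0_lt; rewrite divr_gt0.
pose G (k : R) := h (x + s *: v + k *: (s *: u)) - h (x + k *: (s *: u)).
pose dG (k : R) := s * (g (x + s *: v + k *: (s *: u)) - g (x + k *: (s *: u))).
have GdG (k : R) : is_derive k (1 : R) G (dG k).
  rewrite /dG /g mulrBr; rewrite 2!(dotvC _ u) -2!dotvZl 2!(dotvC (s *: u)).
  by apply: is_deriveB; exact: is_derive_line.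
have cG : {within `[0, 1], continuous G}.
  apply: derivable_within_continuous => k _.
  exact: (@ex_derive _ _ _ _ _ _ _ (GdG k)).
have [c c01] := MVT ltr01 (fun k _ => GdG k) cG.
rewrite /G !scale1r !scale0r !addr0 subr0 mulr1 => ->.
have sb w : `|w| <= K ->
    `|g (x + s *: w) - g x - s * L w| <= e / K * (`|s| * `|w|).
  move=> wK; have : ball 0 r (s *: w).
    rewrite -ball_normE /= sub0r normrN normrZ.
    by rewrite (le_lt_trans (ler_wpM2l _ wK)) // -ltr_pdivlMr.
  by move/rg; rewrite normrZ /L -scalemxAr dotvZl.
have u0 := normr_ge0 u; have v0 := normr_ge0 v.
have cu : `|c *: u| <= `|u|.
  move: c01; rewrite in_itv /= => /andP[c0 c1].
  by rewrite normrZ gtr0_norm // ler_piMl // ltW.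
have vcu : `|v + c *: u| <= `|v| + `|u|.
  by rewrite (le_trans (ler_normD _ _)) // lerD2l.
have cuK : `|c *: u| <= K.
  by rewrite (le_trans cu) // /K; lra.
have vcuK : `|v + c *: u| <= K.
  by rewrite (le_trans vcu) // /K; lra.
have L0 : L (v + c *: u) - L (c *: u) = L v.
  by rewrite /L mulmxDr dotvDl addrK.
rewrite -[dotv _ u]/(L v).
(* Since L(v + c u) - L(c u) = L v, the error is a difference of two first-order remainders of [g]
   at [x], divided by [s]. *)
have -> : L v - s ^- 2 * (s * (g (x + s *: v + c *: (s *: u)) -
    g (x + c *: (s *: u)))) =
    s^-1 * ((g (x + s *: (c *: u)) - g x - s * L (c *: u))
      - (g (x + s *: (v + c *: u)) - g x - s * L (v + c *: u))).
  rewrite -L0 (scalerA c s) (scalerA s c) scalerDr scalerA (mulrC c s) !addrA.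
  by field.
rewrite normrM normfV ler_pdivrMl ?normr_gt0 //.
apply: (le_trans (ler_normB _ _)).
apply: (le_trans (lerD (sb _ cuK) (sb _ vcuK))).
rewrite -mulrDr -mulrDr mulrCA ler_wpM2l // -mulrA ler_piMr ?(ltW e0) //.
rewrite mulrC ler_pdivrMr // mul1r.
apply: (le_trans (lerD cu vcu)).
by rewrite /K; lra.
Unshelve. all: by end_near. Qed.

(** * Symmetry and invertibility of the Hessian *)

(** The second difference is unchanged when [u] and [v] are swapped, and limits are unique. *)
Lemma hess_sym (R : realType) (n : nat) (h : 'cV[R]_n -> R) (x : 'cV[R]_n) :
  (forall y, differentiable h y) -> differentiable (grad h) x ->
  (hess h x)^T = hess h x.
Proof.
move=> dh dgh.
have sym u v : dotv (hess h x *m v) u = dotv (hess h x *m u) v.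
  have := second_difference_cvg (u := u) (v := v) dh dgh.
  have -> : (fun s : R => s ^- 2 * (h (x + s *: v + s *: u) - h (x + s *: u)
      - (h (x + s *: v) - h x))) =
    (fun s : R => s ^- 2 * (h (x + s *: u + s *: v) - h (x + s *: v)
      - (h (x + s *: u) - h x))).
    by apply/funext => s; rewrite (addrAC x); congr (_ * _); ring.
  have /[swap] := second_difference_cvg (u := v) (v := u) dh dgh.
  exact: cvg_unique.
apply/matrixP => i j; rewrite mxE.
have := sym (delta_mx i 0) (delta_mx j 0).
by rewrite !dotv_delta -!colE [LHS]mxE [RHS]mxE => ->.
Qed.

Lemma enorm_sqr (R : realType) (n : nat) (u : 'cV[R]_n) :
  enorm u ^+ 2 = dotv u u.
Proof.
rewrite sqr_sqrtr // dotvE sumr_ge0 // => i _.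
by rewrite -expr2 sqr_ge0.
Qed.

(** For [v] in the kernel the second difference quotient along (v, v) tends to 0, while strong
    convexity keeps it above sigma |v|^2; hence v = 0. *)
Lemma hess_unitmx (R : realType) (n : nat) (h : 'cV[R]_n -> R) (x : 'cV[R]_n) :
  strongly_convex h ->
  (forall y, differentiable h y) -> differentiable (grad h) x ->
  hess h x \in unitmx.
Proof.
move=> [sigma sigma0 sch] dh dgh.
(* Row freeness concerns left kernels, so it is applied to the transpose in order to reach the right
   kernel of the Hessian. *)
rewrite -unitmx_tr -row_free_unit; apply: inj_row_free => w Hw.
apply: trmx_inj; rewrite trmx0; set v := w^T.
have Hv : hess h x *m v = 0 by rewrite -[LHS]trmxK trmx_mul trmxK Hw trmx0.
have vv0 : 0 <= dotv v v by rewrite -enorm_sqr sqr_ge0.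
have := second_difference_cvg (u := v) (v := v) dh dgh.
have -> : dotv (hess h x *m v) v = 0 by rewrite Hv -(scale0r 0) dotvZl mul0r.
move=> lim0.
apply: dotv_eq0; apply/eqP; rewrite eq_le vv0 andbT.
rewrite -(pmulr_rle0 _ sigma0).
(* Strong convexity at the midpoint x + s v of x and x + 2 s v. *)
apply: (cvgr_to_ge lim0); near=> s.
have s0 : 0 < s ^+ 2.
  by rewrite exprn_even_gt0 //=; near: s; exact: nbhs_dnbhs_neq.
rewrite ler_pdivlMl //.
have := sch (x + s *: v + s *: v) x 2^-1; rewrite enorm_sqr.
have -> : x + s *: v + s *: v - x = (2 * s) *: v.
  by apply/colP => i; rewrite !mxE; ring.
rewrite dotvZl dotvC dotvZl.
have -> : 2^-1 *: (x + s *: v + s *: v) + (1 - 2^-1) *: x = x + s *: v.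
  by apply/colP => i; rewrite !mxE; field.
have half : 0 <= (2^-1 : R) <= 1 by lra.
move=> /(_ half).
set D := dotv v v; set H2 := h (x + s *: v + s *: v); set H1 := h (x + _).
by rewrite expr2; lra.
Unshelve. all: by end_near. Qed.

(** * Partial gradients of the Lagrangian *)

Lemma grad_lagrangian_v (R : realType) (n : nat) (h : 'cV[R]_n -> R)
    (ft : 'cV[R]_n -> R -> R) (alpha delta eta mu : R -> R)
    (x v : 'cV[R]_n) (t : R) :
  (forall y, differentiable h y) ->
  grad (fun w => lagrangian h ft alpha delta eta mu x w t) v =
    expR (delta t + eta t - alpha t) *:
      (grad h (x + expR (- alpha t) *: v) - grad h x).
Proof.
move=> dh; set c := expR (- alpha t); apply: grad_is_diff.
have dl : is_diff v (cst x + *:%R c) (0 + *:%R c) by exact: is_diffD.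
have dhl : is_diff v (h \o (cst x + *:%R c))
    (dotv (grad h (x + c *: v)) \o (0 + *:%R c)).
  by apply: is_diff_comp; exact: is_diff_grad.
have ddot : is_diff v ((fun w => dotv w (grad h x)) \o *:%R c)
    ((fun w => dotv w (grad h x)) \o *:%R c).
  by apply: is_diff_comp; exact: is_diff_dotvl.
have := is_diffZ (expR (delta t)) (is_diffB (is_diffZ (expR (eta t))
  (is_diffB (is_diffB dhl (is_diff_cst (h x) v)) ddot))
  (is_diff_cst (ft x (mu t)) v)).
set f := (X in is_diff v X _); set df := (X in is_diff v _ X).
have -> : f = (fun w => lagrangian h ft alpha delta eta mu x w t).
  apply/funext => w; rewrite /f /lagrangian /bregman !fctE /=.
  by rewrite -/c (_ : x + c *: w - x = c *: w) ?(dotvC (grad h x)) // addrAC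
    subrr add0r.
have -> // : df = dotv (expR (delta t + eta t - alpha t) *:
    (grad h (x + c *: v) - grad h x)).
apply/funext => w; rewrite /df !fctE /= !expRD -/c [RHS]dotvZl [in RHS]dotvBl.
rewrite add0r !(dotvC _ (c *: w)) !dotvZl !subr0 !(dotvC w) /GRing.scale /=.
by ring.
Qed.

(** The point [x] enters the Bregman term three times: in both values of [h] and in [grad h x],
    whose variation produces the Hessian term. *)
Lemma grad_lagrangian_x (R : realType) (n : nat) (h : 'cV[R]_n -> R)
    (ft : 'cV[R]_n -> R -> R) (alpha delta eta mu : R -> R)
    (x v : 'cV[R]_n) (t : R) :
  (forall y, differentiable h y) -> differentiable (grad h) x ->
  differentiable (ft^~ (mu t)) x ->
  grad (fun y => lagrangian h ft alpha delta eta mu y v t) x =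
    expR (delta t) *: (expR (eta t) *:
        (grad h (x + expR (- alpha t) *: v) - grad h x
         - expR (- alpha t) *: (hess h x *m v))
      - grad (ft^~ (mu t)) x).
Proof.
move=> dh dgh dft; set c := expR (- alpha t); apply: grad_is_diff.
have dl : is_diff x (id + cst (c *: v)) (id + 0) by exact: is_diffD.
have dhl : is_diff x (h \o (id + cst (c *: v)))
    (dotv (grad h (x + c *: v)) \o (id + 0)).
  by apply: is_diff_comp; exact: is_diff_grad.
have ddot : is_diff x ((fun w => dotv w (c *: v)) \o grad h)
    ((fun w => dotv w (c *: v)) \o mulmx (hess h x)).
  by apply: is_diff_comp; [exact: is_diff_grad_hess | exact: is_diff_dotvl].
have := is_diffZ (expR (delta t)) (is_diffB (is_diffZ (expR (eta t))
  (is_diffB (is_diffB dhl (is_diff_grad (dh x))) ddot)) (is_diff_grad dft)).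
set f := (X in is_diff x X _); set df := (X in is_diff x _ X).
have -> : f = (fun y => lagrangian h ft alpha delta eta mu y v t).
  apply/funext => y; rewrite /f /lagrangian /bregman !fctE /=.
  by rewrite -/c (_ : y + c *: v - y = c *: v) // addrAC subrr add0r.
set g := (X in _ -> is_diff x _ (dotv X)).
have -> // : df = dotv g.
apply/funext => w; rewrite /df !fctE /= addr0 /g.
(* Symmetry moves the Hessian from the increment [w] onto [v], so that the differential takes the
   form of an inner product with [w]. *)
have -> : dotv (hess h x *m w) (c *: v) = c * dotv (hess h x *m v) w.
  by rewrite dotv_mulmx hess_sym // dotvC -scalemxAr dotvZl.
by rewrite !(dotvZl, dotvBl).
Qed.

(** * Calculus of derivatives relative to a set *)

(** Relational form, for which the rules below hold without uniqueness of limits; [derive_in_val]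
    returns to [derive_in] once the filter is proper. *)
Definition is_derive_in (R : realType) (V : normedModType R) (A : set R)
    (g : R -> V) (t : R) (d : V) : Prop :=
  diff_quot g t s @[s --> within A t^'] --> d.

Section derive_in_calculus.
Context (R : realType) (A : set R) (t : R).

Let FF : Filter (within A t^').
Proof. exact: within_filter. Qed.

Let near_neq : \forall s \near within A t^', s != t.
Proof. by have := nbhs_dnbhs_neq t; apply: filterS => s st As. Qed.

Lemma derivable_inP (V : normedModType R) (g : R -> V) :
  derivable_in A g t -> is_derive_in A g t (derive_in A g t).
Proof. by []. Qed.

Lemma derive_in_val (V : normedModType R) (g : R -> V) (d : V) :
  ProperFilter (within A t^') -> is_derive_in A g t d -> derive_in A g t = d.
Proof. by move=> ? gd; apply: cvg_lim. Qed.

Lemma is_derive_in_cst (V : normedModType R) (k : V) :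
  is_derive_in A (cst k) t 0.
Proof.
rewrite /is_derive_in (_ : diff_quot (cst k) t = cst 0); first exact: cvg_cst.
by apply/funext => s; rewrite /diff_quot subrr scaler0.
Qed.

(** Serves for [z], which is prescribed on the interval only. Membership of [t] matters because the
    quotient also involves the value at [t]. *)
Lemma eq_is_derive_in (V : normedModType R) (f g : R -> V) (d : V) :
  A t -> (forall s, A s -> f s = g s) ->
  is_derive_in A f t d -> is_derive_in A g t d.
Proof.
move=> At fg; apply: cvg_trans; apply: near_eq_cvg; near=> s.
have As : A s by near: s; exact: withinT.
by rewrite /diff_quot !fg.
Unshelve. all: by end_near. Qed.

Lemma is_derive_in_cvg (V : normedModType R) (g : R -> V) (d : V) :
  is_derive_in A g t d -> g s @[s --> within A t^'] --> g t.
Proof.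
move=> gd; have st : (s - t) @[s --> within A t^'] --> (0 : R).
  rewrite -(subrr t); apply: cvgB; last exact: cvg_cst.
  exact: cvg_trans (cvg_within _) (cvg_trans (@nbhs_dnbhs _ t) _).
have := cvgD (cvgZ st gd) (cvg_cst (g t)); rewrite scale0r add0r => /(_ FF FF FF) H.
apply: cvg_trans H; apply: near_eq_cvg; near=> s.
have ts : s != t by near: s; exact: near_neq.
by rewrite /diff_quot !fctE scalerA mulfV ?subr_eq0 // scale1r subrK.
Unshelve. all: by end_near. Qed.

Lemma is_derive_inD (V : normedModType R) (f g : R -> V) (df dg : V) :
  is_derive_in A f t df -> is_derive_in A g t dg ->
  is_derive_in A (fun s => f s + g s) t (df + dg).
Proof.
move=> fd gd; rewrite /is_derive_in.
have -> : diff_quot (fun s => f s + g s) t = diff_quot f t + diff_quot g t.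
  by apply/funext => s; rewrite !fctE /diff_quot -scalerDr opprD addrACA.
exact: cvgD.
Qed.

Lemma is_derive_inB (V : normedModType R) (f g : R -> V) (df dg : V) :
  is_derive_in A f t df -> is_derive_in A g t dg ->
  is_derive_in A (fun s => f s - g s) t (df - dg).
Proof.
move=> fd gd; rewrite /is_derive_in.
have -> : diff_quot (fun s => f s - g s) t = diff_quot f t - diff_quot g t.
  by apply/funext => s; rewrite !fctE /diff_quot -scalerBr !opprD addrACA.
exact: cvgB.
Qed.

Lemma is_derive_inZ (V : normedModType R) (k : R -> R) (g : R -> V)
    (dk : R) (dg : V) :
  is_derive_in A k t dk -> is_derive_in A g t dg ->
  is_derive_in A (fun s => k s *: g s) t (dk *: g t + k t *: dg).
Proof.
move=> kd gd; rewrite /is_derive_in.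
(* The first summand keeps [g s], not [g t]; its limit uses continuity of [g] at [t] relative to
   [A]. *)
have -> : diff_quot (fun s => k s *: g s) t =
    (fun s => diff_quot k t s *: g s) + (fun s => k t *: diff_quot g t s).
  apply/funext => s; rewrite !fctE /diff_quot scalerA (mulrC (k t)) -!scalerA.
  by rewrite -scalerDr; congr (_ *: _); rewrite scalerBl scalerBr addrA subrK.
apply: cvgD; first by apply: cvgZ => //; exact: is_derive_in_cvg gd.
by apply: cvgZ => //; exact: cvg_cst.
Qed.

(** The quotient of the composite is [dF] of the quotient of [g] plus a remainder over [s - t]. This
    avoids dividing by [g s - g t], which may vanish. *)
Lemma is_derive_in_comp (V W : normedModType R) (F dF : V -> W) (g : R -> V)
    (d : V) :
  is_diff (g t) F dF -> is_derive_in A g t d ->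
  is_derive_in A (fun s => F (g s)) t (dF d).
Proof.
move=> FdF gd.
have dFE : 'd F (g t) = dF :> (V -> W) by exact: diff_val.
have linF : (linear dF) by rewrite -dFE; exact: linearP.
have contF : continuous dF by rewrite -dFE; exact: diff_continuous.
apply/cvgrPdist_le => e e0.
(* [K] bounds the quotient of [g] near [t], so a remainder below (e / 2 / K) |g s - g t| contributes
   at most e / 2. *)
pose K := `|d| + 1; have K0 : 0 < K by rewrite ltr_wpDl.
have eK : 0 < e / 2 / K by rewrite !divr_gt0.
have gst : g s - g t @[s --> within A t^'] --> 0.
  rewrite -(subrr (g t)).
  by apply: cvgB; [exact: is_derive_in_cvg gd | exact: cvg_cst].
near=> s.
have st : s - t != 0.
  by rewrite subr_eq0; by near: s; exact: near_neq.
have q1 : `|dF d - dF (diff_quot g t s)| <= e / 2.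
  near: s; have := cvg_comp _ _ gd (contF d).
  by move/cvgrPdist_le; apply; rewrite divr_gt0.
have q2 : `|F (g t + (g s - g t)) - F (g t) - dF (g s - g t)|
    <= e / 2 / K * `|g s - g t|.
  by near: s; exact: gst (is_diff_near FdF eK).
have q3 : `|diff_quot g t s| <= K.
  near: s; have /cvgrPdist_le /(_ 1 ltr01) := gd; apply: filterS => s ds.
  rewrite -[diff_quot _ _ _](subrK d) addrC (le_trans (ler_normD _ _)) //.
  by rewrite lerD2l distrC.
pose rho := F (g t + (g s - g t)) - F (g t) - dF (g s - g t).
have -> : diff_quot (F \o g) t s = dF (diff_quot g t s) + (s - t)^-1 *: rho.
  rewrite /rho (addrC (g t)) subrK /diff_quot /=.
  have -> : dF ((s - t)^-1 *: (g s - g t)) = (s - t)^-1 *: dF (g s - g t).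
    by rewrite -dFE linearZ.
  by rewrite -scalerDr [dF _ + _]addrC subrK.
rewrite opprD addrA (le_trans (ler_normB _ _)) // (splitr e) lerD //.
rewrite normrZ normfV ler_pdivrMl ?normr_gt0 // (le_trans q2) //.
have -> : g s - g t = (s - t) *: diff_quot g t s.
  by rewrite /diff_quot scalerA mulfV // scale1r.
rewrite normrZ mulrCA ler_wpM2l // mulrAC ler_pdivrMr // ler_wpM2l //.
by rewrite divr_ge0 // ltW.
Unshelve. all: by end_near. Qed.

Lemma is_derive_in_expR (k : R -> R) (d : R) :
  is_derive_in A k t d ->
  is_derive_in A (fun s => expR (k s)) t (expR (k t) * d).
Proof.
have dexp := @derivable_expR R (k t).
have /differentiableP/is_derive_in_comp H := (derivable1_diffP _ _).1 dexp.
by move=> /H; rewrite (deriv1E dexp) derive1E derive_val mulrC.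
Qed.

End derive_in_calculus.

(** No point of a nondegenerate interval is isolated: step right by at most r / 2, or left when t =
    b. This gives uniqueness of one-sided limits at the endpoints too. *)
Lemma within_itv_proper (R : realType) (a b t : R) :
  a < b -> `[a, b]%classic t -> ProperFilter (within `[a, b]%classic t^').
Proof.
move=> ab; rewrite /= in_itv /= => /andP[ta tb].
split; last exact: within_filter.
rewrite /within /= => /nbhs_ballP[r /= r0 rt].
have [s [sr st [sa sb]]] : exists s : R,
    [/\ `|t - s| < r, s != t & a <= s /\ s <= b].
  have [tb'|bt] := ltP t b.
    exists (Num.min b (t + r / 2)); rewrite minEle; case: ifPn => h;
      rewrite -?ltNge in h; split; rewrite ?ltr_norml ?gt_eqF //; lra.
  exists (Num.max a (t - r / 2)); rewrite maxEle; case: ifPn => h;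
    rewrite -?ltNge in h; split; rewrite ?ltr_norml ?lt_eqF //; lra.
by apply: (rt s sr st); rewrite /= in_itv /= sa sb.
Qed.

(** * Algebra of the residuals *)

(** [Hz] and [Hx] stand for the Hessians at z and x applied to z' and x', and [k] for delta' + eta'
    - alpha'. The [Hx] terms cancel, and the [G] term of the x-gradient turns [k] into k -
    e^alpha. *)
Lemma euler_lagrange_residual (R : realType) (n : nat)
    (G F Hz Hx : 'cV[R]_n) (a d e k : R) :
  (expR (d + e - a) * k) *: G + expR (d + e - a) *: (Hz - Hx)
    - expR d *: (expR e *: (G - expR (- a) *: Hx) - F) =
  expR (d + e - a) *: (Hz + (k - expR a) *: G + expR (- e + a) *: F).
Proof.
apply/colP => i; rewrite !mxE !(expRD, expRN).
by field; rewrite !gt_eqF ?expR_gt0.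
Qed.

(** Here [G] and [F] are already multiplied by the inverse Hessian, [k] is the full coefficient of
    the state equation, and the first three terms in the right-hand bracket are z'. *)
Lemma second_order_residual (R : realType) (n : nat)
    (x1 x2 G F : 'cV[R]_n) (a e a1 k : R) :
  x2 + (expR a - a1) *: x1 + ((expR a * k) *: G + expR (- e + 2 * a) *: F) =
  expR a *: (x1 + ((expR (- a) * - a1) *: x1 + expR (- a) *: x2)
    + (k *: G + expR (- e + a) *: F)).
Proof.
apply/colP => i; rewrite !mxE mulr_natl mulr2n !(expRD, expRN).
by field; rewrite !gt_eqF ?expR_gt0.
Qed.

(** * Equivalence of the three equations *)

Theorem corollary4 (R : realType) (n : nat) (t0 T : R)
    (alpha delta eta mu : R -> R)
    (h f : 'cV[R]_n -> R) (ft : 'cV[R]_n -> R -> R) (a beta : R)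
    (x z : R -> 'cV[R]_n) :
  let I : set R := `[t0, T]%classic in
  t0 < T ->
  (forall t, I t -> derivable_in I alpha t) ->
  (forall t, I t -> derivable_in I delta t) ->
  (forall t, I t -> derivable_in I eta t) ->
  (forall t, I t -> derivable_in I mu t) ->
  (forall t, I t -> 0 < mu t) ->
  twice_differentiable h ->
  strongly_convex h ->
  convex_function setT f ->
  smooth_approximation f ft a beta ->
  twice_derivable_in I x ->
  (forall t, I t -> z t = x t + expR (- alpha t) *: derive_in I x t) ->
  forall t, I t ->
    [/\ hess h (z t) \in unitmx,
        euler_lagrange I (lagrangian h ft alpha delta eta mu) x t <->
          state_equation I h ft alpha delta eta mu x z t &
        state_equation I h ft alpha delta eta mu x z t <->
          second_order_ode I h ft alpha delta eta mu x z t].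
Proof.
move=> I t0T dalpha ddelta deta _ mu0 [dh dgh] sch _ [_ _ smooth] dx zE t It.
have PF := within_itv_proper t0T It.
have Hunit := hess_unitmx sch dh (dgh (z t)).
set H := hess h (z t) in Hunit *.
have [dx1 dx2] := dx t It.
have /derivable_inP xD := dx1; have /derivable_inP x2D := dx2.
have /derivable_inP aD := dalpha t It.
have /derivable_inP dD := ddelta t It.
have /derivable_inP eD := deta t It.
set x1 := derive_in I x in zE xD x2D *.
set x2 := derive_in I x1 t in x2D *.
set a1 := derive_in I alpha t in aD *.
set d1 := derive_in I delta t in dD *.
set e1 := derive_in I eta t in eD *.
pose phi s := delta s + eta s - alpha s.
have phiD := is_derive_in_expR (is_derive_inB (is_derive_inD dD eD) aD).
pose c s := expR (- alpha s).
have cD : is_derive_in I c t (expR (- alpha t) * - a1).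
  apply: is_derive_in_expR; rewrite -sub0r.
  have := is_derive_inB (is_derive_in_cst I t 0) aD.
  by under eq_fun do rewrite sub0r.
(* [z0] is the formula for [z] on the whole line. The gradient in v has exactly this argument, so
   the derivatives are taken through [z0] and transferred to [z]. *)
pose z0 s := x s + c s *: x1 s.
have z0D := is_derive_inD xD (is_derive_inZ cD x2D).
have z0t : z0 t = z t by rewrite zE.
have zD : derive_in I z t =
    x1 t + ((expR (- alpha t) * - a1) *: x1 t + c t *: x2).
  by apply: derive_in_val; apply: eq_is_derive_in z0D => // s /zE.
set z1 := derive_in I z t in zD *.
have gzD : is_derive_in I (fun s => grad h (z0 s)) t (H *m z1).
  rewrite zD; apply: is_derive_in_comp z0D.
  by rewrite /H -z0t; exact: is_diff_grad_hess.
have gxD := is_derive_in_comp (is_diff_grad_hess (dgh (x t))) xD.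
(* Time derivative of the momentum e^phi (grad h(z0) - grad h(x)), the first term of the
   Euler-Lagrange equation. *)
have momD := is_derive_inZ phiD (is_derive_inB gzD gxD).
have dft : differentiable (ft^~ (mu t)) (x t).
  by have [_ + _ _] := smooth _ (mu0 t It); apply.
set G := grad h (z t) - grad h (x t).
set F := grad (ft^~ (mu t)) (x t).
set rho := d1 + e1 - a1 - expR (alpha t).
have eq0_iff (P Q : 'cV[R]_n) : P = Q -> (P = 0 <-> Q = 0) by move=> ->.
pose residual := H *m z1 + rho *: G + expR (- eta t + alpha t) *: F.
have EL : euler_lagrange I (lagrangian h ft alpha delta eta mu) x t <->
    expR (phi t) *: residual = 0.
  rewrite /euler_lagrange -/x1.
  under eq_fun do rewrite grad_lagrangian_v //.
  rewrite (derive_in_val PF momD) grad_lagrangian_x //.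
  rewrite -/(c t) -/(z0 t) z0t -/G -/F /residual.
  by apply: eq0_iff; exact: euler_lagrange_residual.
(* The first state equation follows from the definition of [z], as e^alpha e^-alpha = 1; only the
   second one carries a condition. *)
have ST : state_equation I h ft alpha delta eta mu x z t <-> residual = 0.
  rewrite /state_equation -/x1 -/d1 -/e1 -/a1 -/rho -/G -/H -/F -/z1 /residual.
  split=> [[_ ->]|R0]; first by rewrite -addrA -opprD addNr.
  split; last by apply/eqP; rewrite -opprD -addr_eq0 addrA R0.
  by rewrite zE // addrAC subrr add0r scalerA -expRD subrr expR0 scale1r.
have ODE : second_order_ode I h ft alpha delta eta mu x z t <->
    expR (alpha t) *: (invmx H *m residual) = 0.
  rewrite /second_order_ode -/x1 -/x2 -/d1 -/e1 -/a1 -/rho -/G -/H -/F.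
  have -> : invmx H *m residual =
      z1 + (rho *: (invmx H *m G) + expR (- eta t + alpha t) *: (invmx H *m F)).
    by rewrite /residual -addrA mulmxDr mulKmx // mulmxDr -!scalemxAr.
  rewrite mulmxDr -!scalemxAr [z1]zD.
  by apply: eq0_iff; exact: second_order_residual.
split => //.
(* Each form is the residual up to a positive exponential and, for the ODE, an invertible matrix;
   both can be cancelled. *)
- rewrite EL ST; split=> [/eqP|->]; last by rewrite scaler0.
  by rewrite scaler_eq0 gt_eqF ?expR_gt0 //= => /eqP.
- rewrite ST ODE; split=> [->|/eqP]; first by rewrite mulmx0 scaler0.
  rewrite scaler_eq0 gt_eqF ?expR_gt0 //= => /eqP R0.
  by rewrite -(mulKVmx Hunit residual) R0 mulmx0.
Qed.
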